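(* Let $\mathcal{V}$ be a vector space over a field $\mathbb{F}$, let $\ell\ge1$, $L=\{0,1,\ldots,\ell\}$, and let $P=P_0P_1\cdots P_\ell:\mathcal{V}\to\mathcal{V}$ with linear operators $P_i:\mathcal{V}\to\mathcal{V}$. Suppose that in the sequence $\mathcal{V}(0)\to\mathcal{V}(1)\to\cdots\to\mathcal{V}(\ell+1)$ associated to $(P_0,\ldots,P_\ell)$ every diamond is exact. Fix $f\in\mathcal{V}$, and write $\mathcal{V}_P^f$ for the solution space of $Pu=f$ and $\mathcal{V}_i^f$ for the solution space of $P_i\tilde u=f$. Then: (a) There is a 1-1 relationship between solutions $u\in\mathcal{V}$ of $Pu=f$ and solutions $(u^0,\ldots,u^\ell)\in\bigoplus^{\ell+1}\mathcal{V}$ of $P_iu^i=f$, $i=0,1,\ldots,\ell$. It is given by the map $F:\mathcal{V}_P^f\to\times_{i=0}^{\ell}\mathcal{V}_i^f$, $u\mapsto(P^0u,\ldots,P^\ell u)$, with inverse the map $B':\times_{i=0}^{\ell}\mathcal{V}_i^f\to\mathcal{V}_P^f$ which sends $(u^0,\ldots,u^\ell)\in\mathcal{V}_{L\setminus\{0\}}\oplus\cdots\oplus\mathcal{V}_{L\setminus\{\ell\}}$ solving $P_iu^i=f$ ($i=0,\ldots,\ell$) to its unique preimage under $F$ in $\mathcal{V}_\emptyset=\mathcal{V}$. Thus $B'\circ F$ is the identity (for every $u\in\mathcal{V}$, taking $f=Pu$, one has $B'(F(u))=u$) and $F\circ B'$ is the identity on $\times_{i=0}^{\ell}\mathcal{V}_i^f$.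 (b) $$\mathcal{R}(P)=\bigcap_{i=0}^{\ell}\mathcal{R}(P_i),\qquad\mathcal{N}(P)\cong\bigoplus_{i=0}^{\ell}\mathcal{N}(P_i).$$
   Context: $\mathcal{R}(A)$, $\mathcal{N}(A)$ denote image and kernel of $A$; $P^i:=\prod_{j\ne i,\,0\le j\le\ell}P_j$. For $J\subseteq L$ let $\mathcal{V}_J:=\mathcal{V}$ be a copy of $\mathcal{V}$, and for $i\in L\setminus J$ let $P_{J,i}:=(-1)^{|\{j\in J:\,j<i\}|}P_i:\mathcal{V}_J\to\mathcal{V}_{J\cup\{i\}}$. Put $\mathcal{V}(p):=\bigoplus_{|J|=p}\mathcal{V}_J$, with maps $P(p):\mathcal{V}(p)\to\mathcal{V}(p+1)$ the sum of all $P_{J,i}$ with $|J|=p$, $i\notin J$. For $J\subseteq L$ and $i<j$ in $L\setminus J$, the corresponding diamond is the sequence $$0\to\mathcal{V}_J\xrightarrow{(P_{J,i},\,P_{J,j})}\mathcal{V}_{J\cup\{i\}}\oplus\mathcal{V}_{J\cup\{j\}}\xrightarrow{P_{J\cup\{i\},j}+P_{J\cup\{j\},i}}\mathcal{V}_{J\cup\{i,j\}}\to0,$$ where the first map is $v\mapsto(P_{J,i}v,P_{J,j}v)$ and the second is $(v,w)\mapsto P_{J\cup\{i\},j}v+P_{J\cup\{j\},i}w$. The diamond is exact if this is an exact sequence (in particular a complex). *)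

(* Defs.v *)
From HB Require Import structures.
From mathcomp Require Import all_boot all_order all_algebra.
From mathcomp Require Import boolp classical_sets functions.

Set Implicit Arguments.
Unset Strict Implicit.
Unset Printing Implicit Defensive.

Import GRing.Theory.
Local Open Scope ring_scope.

Section Kernel.
Variables (F : fieldType) (U W : lmodType F) (f : {linear U -> W}).

Definition kerp : {pred U} := fun x => f x == 0.

Fact kerp_submod_closed : submod_closed kerp.
Proof.
split=> [|a u v]; rewrite /kerp !unfold_in ?linear0 //.
by move=> /eqP fu /eqP fv; rewrite linearP fu fv scaler0 addr0.
Qed.

HB.instance Definition _ := GRing.isSubmodClosed.Build F U kerp kerp_submod_closed.

Definition ker := {x : U | x \in kerp}.

HB.instance Definition _ := SubType.on ker.
HB.instance Definition _ := Choice.on ker.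
HB.instance Definition _ := [SubChoice_isSubLmodule of ker by <:].
End Kernel.

Section DirectSum.
Variables (F : fieldType) (I : finType) (W : I -> lmodType F).

(* As I is finite, the direct sum is the product, here with the pointwise
   operations (the library only provides them for non-dependent {ffun _}). *)
Definition dirsum := {dffun forall i, W i}.

HB.instance Definition _ := Choice.on dirsum.

Implicit Types x y z : dirsum.

Definition dirsum_zero : dirsum := finfun (fun i => 0 : W i).
Definition dirsum_opp x : dirsum := finfun (fun i => - x i).
Definition dirsum_add x y : dirsum := finfun (fun i => x i + y i).
Definition dirsum_scale (a : F) x : dirsum := finfun (fun i => a *: x i).

Fact dirsum_addA : associative dirsum_add.
Proof. by move=> x y z; apply/ffunP=> i; rewrite !ffunE addrA. Qed.
Fact dirsum_addC : commutative dirsum_add.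
Proof. by move=> x y; apply/ffunP=> i; rewrite !ffunE addrC. Qed.
Fact dirsum_add0 : left_id dirsum_zero dirsum_add.
Proof. by move=> x; apply/ffunP=> i; rewrite !ffunE add0r. Qed.
Fact dirsum_addN : left_inverse dirsum_zero dirsum_opp dirsum_add.
Proof. by move=> x; apply/ffunP=> i; rewrite !ffunE addNr. Qed.

HB.instance Definition _ := GRing.isZmodule.Build dirsum
  dirsum_addA dirsum_addC dirsum_add0 dirsum_addN.

Fact dirsum_scaleA a b x :
  dirsum_scale a (dirsum_scale b x) = dirsum_scale (a * b) x.
Proof. by apply/ffunP=> i; rewrite !ffunE scalerA. Qed.
Fact dirsum_scale1 : left_id 1 dirsum_scale.
Proof. by move=> x; apply/ffunP=> i; rewrite !ffunE scale1r. Qed.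
Fact dirsum_scaleDr : right_distributive dirsum_scale +%R.
Proof. by move=> a x y; apply/ffunP=> i; rewrite !ffunE scalerDr. Qed.
Fact dirsum_scaleDl x : {morph dirsum_scale^~ x : a b / a + b}.
Proof. by move=> a b; apply/ffunP=> i; rewrite !ffunE scalerDl. Qed.

HB.instance Definition _ := GRing.Zmodule_isLmodule.Build F dirsum
  dirsum_scaleA dirsum_scale1 dirsum_scaleDr dirsum_scaleDl.
End DirectSum.

Definition lmod_iso (F : fieldType) (U W : lmodType F) : Prop :=
  exists phi : {linear U -> W}, bijective phi.

Definition short_exact (A B C : zmodType) (f : A -> B) (g : B -> C) : Prop :=
  [/\ injective f, range f = (g @^-1` [set 0])%classic & range g = setT].

Section Operators.
Variables (F : fieldType) (V : lmodType F) (l : nat).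
Variable P : 'I_l.+1 -> {linear V -> V}.

Definition lcomp (f g : {linear V -> V}) : {linear V -> V} := f \o g.

(* The big operator composes in increasing order of the index:
   Pprod = P_0 \o P_1 \o ... \o P_l, and Pcompl i omits the factor P_i. *)
Definition Pprod : {linear V -> V} :=
  \big[lcomp/(idfun : {linear V -> V})]_(j < l.+1) P j.

Definition Pcompl (i : 'I_l.+1) : {linear V -> V} :=
  \big[lcomp/(idfun : {linear V -> V})]_(j < l.+1 | j != i) P j.

(* P_{J,i} : V_J -> V_{J u {i}}; every V_J is V itself. *)
Definition PJ (J : {set 'I_l.+1}) (i : 'I_l.+1) : {linear V -> V} :=
  (-1) ^+ #|[pred j in J | (j < i)%N]| \*: P i.

Definition diamond_in (J : {set 'I_l.+1}) (i j : 'I_l.+1) (v : V) : V * V :=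
  (PJ J i v, PJ J j v).

Definition diamond_out (J : {set 'I_l.+1}) (i j : 'I_l.+1) (vw : V * V) : V :=
  PJ (i |: J) j vw.1 + PJ (j |: J) i vw.2.

Definition diamond_exact (J : {set 'I_l.+1}) (i j : 'I_l.+1) : Prop :=
  short_exact (diamond_in J i j) (diamond_out J i j).

Definition all_diamonds_exact : Prop :=
  forall (J : {set 'I_l.+1}) (i j : 'I_l.+1),
    i \notin J -> j \notin J -> (i < j)%N -> diamond_exact J i j.

Definition sol (A : V -> V) (f : V) : set V := [set u | A u = f]%classic.

Definition sol_prod (f : V) : set {ffun 'I_l.+1 -> V} :=
  [set us | forall i, us i \in sol (P i) f]%classic.

Definition Fmap (u : V) : {ffun 'I_l.+1 -> V} := [ffun i => Pcompl i u].

(* A preimage under Fmap if there is one, and 0 otherwise. *)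
Definition Bmap (us : {ffun 'I_l.+1 -> V}) : V :=
  xget 0 [set u | Fmap u = us]%classic.
End Operators.

(* Main.v *)
Require Import Defs.
From HB Require Import structures.
From mathcomp Require Import all_boot all_order all_algebra.
From mathcomp Require Import boolp classical_sets functions.

(** Exactness of the diamonds starting at the empty set makes any two
    distinct operators [A = P_i] and [B = P_j] form a pullback square: they
    commute, their kernels meet only in 0, and [A v = B w] forces [v = B u] and
    [w = A u] for some [u] ([cartesian_pair] below).  Such squares
    can be pasted: if [(A, B)] and [(A, C)] have this property, so does
    [(A, B C)] ([cartesian_pair_comp]).  Hence each [P_i] forms a cartesian pair
    with every product of other operators.

    The theorem follows by adding the factors one at a time.  Write [P_t] for the
    product over [t], and call [w] a common origin of the solutions [u^j],
    [j \in t], if [P_t w = f] and each [u^j] is the image of [w] under the product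
    over [t] without [j].  For a new index [i], [P_i u^i = f = P_t w], and the
    cartesian pair [(P_i, P_t)] yields [u] with [P_t u = u^i] and [P_i u = w],
    which is a common origin for all factors ([ex_common_origin]).  The same
    induction shows that only 0 has all its images equal to 0
    ([common_origin_eq0]).  So [Fmap P] is injective and reaches every tuple of
    solutions; the range statement is the solvability half of this, and the
    kernel statement is the case [f = 0]. *)

Set Implicit Arguments.
Unset Strict Implicit.
Unset Printing Implicit Defensive.

Import GRing.Theory.
Local Open Scope classical_set_scope.
Local Open Scope ring_scope.

(** * Pullback squares of commuting operators *)

Section CartesianPairs.
Variables (F : fieldType) (V : lmodType F).
Implicit Types A B C : {linear V -> V}.

(** The commutative square [A \o B = B \o A] is a pullback: through
    [u |-> (B u, A u)], [V] is the fibre product of [A] and [B]. *)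
Definition cartesian_pair A B : Prop :=
  [/\ forall v, A (B v) = B (A v),
      forall v, A v = 0 -> B v = 0 -> v = 0
    & forall v w, A v = B w -> exists2 u, B u = v & A u = w].

Lemma cartesian_pairC A B : cartesian_pair A B -> cartesian_pair B A.
Proof.
move=> [AB kAB lAB]; split=> [v|v Bv Av|v w Bv_Aw]; first by rewrite AB.
  exact: kAB.
by have [u Bu Au] := lAB w v (esym Bv_Aw); exists u.
Qed.

Lemma cartesian_pair_id A : cartesian_pair A (idfun : {linear V -> V}).
Proof. by split=> // v w /= <-; exists v. Qed.

(** Pasting of pullback squares: from [A v = B (C w)], the pair [(A, B)] lifts
    [(v, C w)] to some [u] with [A u = C w], and [(A, C)] then lifts
    [(u, w)]. *)
Lemma cartesian_pair_comp A B C :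
  cartesian_pair A B -> cartesian_pair A C -> cartesian_pair A (lcomp B C).
Proof.
move=> [AB kAB lAB] [AC kAC lAC]; split=> [v|v Av BCv|v w /= Av].
- by rewrite /= AB AC.
- by apply: kAC => //; apply: kAB => //; rewrite AC Av linear0.
have [u Bu Au] := lAB _ _ Av.
have [t Ct At] := lAC _ _ Au.
by exists t => //=; rewrite Ct.
Qed.

End CartesianPairs.

(** * Tuples of solutions for a family of cartesian pairs *)

Section CommonOrigin.
Variables (F : fieldType) (V : lmodType F) (T : eqType).
Variable P : T -> {linear V -> V}.
Hypothesis cartP : forall i j, i != j -> cartesian_pair (P i) (P j).
Implicit Types (i j : T) (s : seq T).

Definition Lprod s : {linear V -> V} :=
  \big[@lcomp F V/(idfun : {linear V -> V})]_(j <- s) P j.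

Lemma Lprod_nil u : Lprod [::] u = u.
Proof. by rewrite /Lprod big_nil. Qed.

Lemma Lprod_cons i s u : Lprod (i :: s) u = P i (Lprod s u).
Proof. by rewrite /Lprod big_cons. Qed.

Lemma P_commute i j u : P i (P j u) = P j (P i u).
Proof. by have [->//|/cartP[]] := eqVneq i j. Qed.

Lemma Lprod_commute i s u : P i (Lprod s u) = Lprod s (P i u).
Proof.
by elim: s => [|j s IHs]; rewrite ?Lprod_nil // !Lprod_cons P_commute IHs.
Qed.

Lemma cartesian_pair_Lprod i s :
  i \notin s -> cartesian_pair (P i) (Lprod s).
Proof.
elim: s => [_|j s IHs]; rewrite /Lprod ?big_nil ?big_cons.
  exact: cartesian_pair_id.
rewrite inE negb_or => /andP[ij /IHs].
exact/cartesian_pair_comp/cartP.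
Qed.

Definition skip i s := [seq j <- s | j != i].
Arguments skip : simpl never.

Lemma skip_notin i s : i \notin s -> skip i s = s.
Proof. by move=> is_; apply/all_filterP/allP => j; apply: contraTneq => ->. Qed.

Lemma Lprod_skip i s u :
  uniq s -> i \in s -> P i (Lprod (skip i s) u) = Lprod s u.
Proof.
elim: s => //= j s IHs /andP[js us]; rewrite inE /skip /=.
case: eqVneq => [-> _|_ /= is_]; rewrite Lprod_cons.
  by rewrite -/(skip j s) skip_notin.
by rewrite Lprod_cons P_commute IHs.
Qed.

Lemma Lprod_skip_cons i j s u : i \notin s -> j \in s ->
  Lprod (skip j (i :: s)) u = Lprod (skip j s) (P i u).
Proof.
move=> is_ js; rewrite /skip /= ifT; last by apply: contraNneq is_ => ->.
by rewrite Lprod_cons Lprod_commute.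
Qed.

Lemma Lprod_skip_head i s u :
  i \notin s -> Lprod (skip i (i :: s)) u = Lprod s u.
Proof. by move=> is_; rewrite /skip /= eqxx -/(skip i s) skip_notin. Qed.

(** The conjunct [Lprod s u = f] follows from the other one when [s] is not
    empty; it lets the induction start from the empty product, where [u = f]. *)
Lemma ex_common_origin s (f : V) (us : T -> V) :
    uniq s -> {in s, forall i, P i (us i) = f} ->
  exists2 u, Lprod s u = f & {in s, forall i, Lprod (skip i s) u = us i}.
Proof.
elim: s => [_ _|i s IHs /= /andP[is_ us_] Pus].
  by exists f => //; rewrite Lprod_nil.
have [|w Pw Pw_us] := IHs us_.
  by move=> j js; apply: Pus; rewrite inE js orbT.
have [_ _ lift] := cartesian_pair_Lprod is_.
have [|u Psu Piu] := lift (us i) w; first by rewrite Pus ?mem_head.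
exists u; first by rewrite Lprod_cons Lprod_commute Piu.
move=> j; rewrite inE; case: eqVneq => [-> _|_ /= js].
  by rewrite Lprod_skip_head.
by rewrite Lprod_skip_cons // Piu Pw_us.
Qed.

(** As above, the hypothesis on [Lprod s u] is there for the empty product. *)
Lemma common_origin_eq0 s u :
    uniq s -> Lprod s u = 0 -> {in s, forall i, Lprod (skip i s) u = 0} ->
  u = 0.
Proof.
elim: s u => [|i s IHs] u; first by rewrite Lprod_nil.
move=> /= /andP[is_ us_] Pu Psu.
have [_ ker0 _] := cartesian_pair_Lprod is_.
apply: ker0; last by rewrite -(Lprod_skip_head _ is_) Psu ?mem_head.
apply: IHs => //; first by rewrite -Lprod_commute -Lprod_cons.
by move=> j js; rewrite -Lprod_skip_cons // Psu // inE js orbT.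
Qed.

End CommonOrigin.

(** * Operators with exact diamonds *)

Section Diamonds.
Variables (F : fieldType) (V : lmodType F) (l : nat).
Variable P : 'I_l.+1 -> {linear V -> V}.

Lemma PJ_set0 i v : PJ P finset.set0 i v = P i v.
Proof. by rewrite /PJ /= eq_card0 ?scale1r // => j; rewrite !inE. Qed.

Lemma PJ_set1 i j v :
  PJ P (i |: finset.set0) j v = (-1) ^+ (i < j)%N *: P j v.
Proof.
rewrite /PJ /= finset.setU0; congr (_ ^+ _ *: _).
have [ij|ji] := boolP (i < j)%N.
  rewrite -[RHS](card1 i); apply: eq_card => k; rewrite !inE.
  by case: eqVneq => // ->; rewrite ij.
by apply: eq_card0 => k; rewrite !inE; case: eqVneq => // ->; apply/negbTE.
Qed.

(** For [i < j] the only sign in the diamond at the empty set is that of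
    [P_{{i},j} = - P_j].  Its second map is thus [(v, w) |-> P_i w - P_j v]:
    commutation says that the diamond is a complex, trivial intersection of the
    kernels that its first map is injective, and lifting that it is exact in the
    middle. *)
Lemma diamond_cartesian_pair (i j : 'I_l.+1) : (i < j)%N ->
  diamond_exact P finset.set0 i j -> cartesian_pair (P i) (P j).
Proof.
move=> ij [inj_in im_ker _].
have outE v w : diamond_out P finset.set0 i j (v, w) = P i w - P j v.
  rewrite /diamond_out !PJ_set1 ij ltnNge (ltnW ij) /=.
  by rewrite expr0 expr1 scaleN1r scale1r addrC.
have inE_ v : diamond_in P finset.set0 i j v = (P i v, P j v).
  by rewrite /diamond_in !PJ_set0.
split=> [v|v Pi Pj|v w PP].
- have : range (diamond_in P finset.set0 i j) (P i v, P j v).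
    by exists v; rewrite ?inE_.
  by rewrite im_ker /preimage /= outE => /subr0_eq.
- by apply: inj_in; rewrite !inE_ Pi Pj !linear0.
have : range (diamond_in P finset.set0 i j) (w, v).
  by rewrite im_ker /preimage /= outE PP subrr.
by move=> [u _]; rewrite inE_ => -[Piu Pju]; exists u.
Qed.

Hypothesis hP : all_diamonds_exact P.

Lemma diamonds_cartesian i j : i != j -> cartesian_pair (P i) (P j).
Proof.
have lt_cart (a b : 'I_l.+1) : (a < b)%N -> cartesian_pair (P a) (P b).
  by move=> ab; apply/diamond_cartesian_pair/hP; rewrite // finset.in_set0.
rewrite -val_eqE neq_ltn => /orP[]/lt_cart //.
exact: cartesian_pairC.
Qed.

Let s := index_enum 'I_l.+1.

Lemma PcomplE i : Pcompl P i = Lprod P (skip i s).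
Proof. by rewrite /Lprod /skip big_filter. Qed.

Lemma P_Pcompl i u : P i (Pcompl P i u) = Pprod P u.
Proof.
rewrite PcomplE Lprod_skip ?index_enum_uniq ?mem_index_enum //.
exact: diamonds_cartesian.
Qed.

Lemma Fmap_inj : injective (Fmap P).
Proof.
move=> u v Fuv.
have Puv i : Pcompl P i (u - v) = 0.
  move/ffunP/(_ i): Fuv; rewrite !ffunE => Fuv.
  by rewrite linearB /= Fuv subrr.
apply: subr0_eq; apply: (common_origin_eq0 diamonds_cartesian (s := s)).
- exact: index_enum_uniq.
- by rewrite -[LHS](P_Pcompl ord0) Puv linear0.
by move=> i _; rewrite -PcomplE.
Qed.

Lemma Fmap_surj f us : sol_prod P f us ->
  exists2 u, sol (Pprod P) f u & Fmap P u = us.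
Proof.
move=> Pus.
have [|u Pu Fu] := @ex_common_origin _ _ _ _ diamonds_cartesian s f us
  (index_enum_uniq _).
  by move=> i _; apply: set_mem (Pus i).
exists u => //; apply/ffunP=> i.
by rewrite ffunE PcomplE Fu // mem_index_enum.
Qed.

Lemma Fmap_sol f u : sol (Pprod P) f u -> sol_prod P f (Fmap P u).
Proof. by move=> Pu i; rewrite in_setE /sol /= ffunE P_Pcompl. Qed.

Lemma FmapK : cancel (Fmap P) (Bmap P).
Proof.
move=> u; apply: Fmap_inj; rewrite /Bmap.
by case: xgetP => [v _ //|/(_ u)]; case.
Qed.

Lemma range_Pprod :
  range (Pprod P) = \bigcap_(i in [set: 'I_l.+1]) range (P i).
Proof.
apply/seteqP; split=> f.
  by move=> [u _ <-] i _; exists (Pcompl P i u) => //; apply: P_Pcompl.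
move=> Rf.
have {}Rf i : exists v, P i v = f by have [v _ <-] := Rf i I; exists v.
have [|u Pu _] := @Fmap_surj f [ffun i => sval (cid (Rf i))].
  by move=> i; rewrite in_setE /sol /= ffunE; case: cid.
by exists u.
Qed.

Lemma Pcompl_ker i (u : ker (Pprod P)) : Pcompl P i (val u) \in kerp (P i).
Proof. by rewrite unfold_in P_Pcompl; apply: (valP u). Qed.

Definition Fker (u : ker (Pprod P)) : dirsum (fun i => ker (P i)) :=
  finfun (fun i => Sub (Pcompl P i (val u)) (Pcompl_ker i u) : ker (P i)).

Lemma Fker_linear : linear Fker.
Proof.
move=> a u v; apply/ffunP=> i; apply: val_inj.
by rewrite !ffunE /= linearP.
Qed.

HB.instance Definition _ := GRing.isLinear.Build F
  (ker (Pprod P)) (dirsum (fun i => ker (P i))) *:%R Fker Fker_linear.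

Lemma Fker_bij : bijective Fker.
Proof.
rewrite -setTT_bijective; split=> // [u v _ _ Fuv|w _].
  apply/val_inj/Fmap_inj/ffunP=> i; rewrite !ffunE.
  by move/ffunP/(_ i)/(congr1 val): Fuv; rewrite !ffunE.
have [|u Pu Fu] := @Fmap_surj 0 [ffun i => val (w i)].
  by move=> i; rewrite in_setE /sol /= ffunE; apply/eqP/(valP (w i)).
have ku : u \in kerp (Pprod P) by apply/eqP.
exists (Sub u ku : ker (Pprod P)) => //.
apply/ffunP=> i; apply: val_inj; rewrite ffunE /=.
by move/ffunP/(_ i): Fu; rewrite !ffunE.
Qed.

End Diamonds.

Unset Implicit Arguments.

Theorem theorem2p12 (F : fieldType) (V : lmodType F) (l : nat) (hl : (1 <= l)%N)
    (P : 'I_l.+1 -> {linear V -> V}) (hP : all_diamonds_exact P) (f : V) :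
  ([/\ set_bij (sol (Pprod P) f) (sol_prod P f) (Fmap P),
       set_bij (sol_prod P f) (sol (Pprod P) f) (Bmap P),
       forall us, sol_prod P f us -> exists! u : V, Fmap P u = us,
       forall u, Bmap P (Fmap P u) = u
     & forall us, sol_prod P f us -> Fmap P (Bmap P us) = us])
  /\ (range (Pprod P) = \bigcap_(i in [set: 'I_l.+1]) range (P i)
      /\ lmod_iso (ker (Pprod P)) (dirsum (fun i : 'I_l.+1 => ker (P i)))).
Proof.
have FK := FmapK hP.
have BK us : sol_prod P f us -> Fmap P (Bmap P us) = us.
  by move=> /(Fmap_surj hP)[u _ <-]; rewrite FK.
split; last first.
  by split; [exact: range_Pprod | exists (Fker hP); exact: Fker_bij].
split=> //.
- split=> [u|u v _ _|us].
  + exact: Fmap_sol.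
  + exact: Fmap_inj.
  + exact: Fmap_surj.
- split=> [us|us vs|u Pu].
  + by move=> /(Fmap_surj hP)[u Pu <-]; rewrite FK.
  + by rewrite !inE => /BK {2}<- /BK {2}<- ->.
  + by exists (Fmap P u); [exact: Fmap_sol | exact: FK].
- move=> us /(Fmap_surj hP)[u _ Fu]; exists u; split=> // v Fv.
  by apply: (Fmap_inj hP); rewrite Fu.
Qed.
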